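(* The sloping binary numbers $s(n)$ have average order $n+O(\log n)$; that is, as $N\to\infty$, $\sum_{n=1}^{N}s(n)=\sum_{n=1}^{N}n+O(N\log N)$.
   Context: For integers $m\ge 0$, $k\ge0$ let $\operatorname{bit}_k(m)=\lfloor m/2^k\rfloor\bmod 2$. For $n\ge 0$ the sloping binary number is $s(n)=\sum_{k\ge 0}\operatorname{bit}_k(n+k)2^k$ (the $2^k$ digit of $s(n)$ is the $2^k$ digit of $n+k$). ''Average order'' is in the sense of Hardy and Wright: a function $g$ is an average order of $s$ if $\sum_{n\le N}s(n)\sim\sum_{n\le N}g(n)$; here the claim is the quantitative statement given. *)

(* Defs.v *)
From mathcomp Require Export all_boot all_order all_algebra.
From mathcomp Require Export all_classical all_reals all_analysis.
From mathcomp Require Import zify.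
Export numFieldNormedType.Exports.

Set Implicit Arguments.
Unset Strict Implicit.
Unset Printing Implicit Defensive.

Local Open Scope classical_set_scope.
Local Open Scope nat_scope.

Definition bit (k m : nat) : nat := (m %/ 2 ^ k) %% 2.

(* The sum over all k : nat only has finitely many nonzero terms
   (see bit_sloping_eq0), so it does not fall back on the default value
   of sums with infinite support. *)
Definition sloping (n : nat) : nat :=
  \big[addn/0]_(k \in [set: nat]) (bit k (n + k) * 2 ^ k).

Lemma bit_sloping_eq0 (n k : nat) : n < k -> bit k (n + k) = 0.
Proof.
move=> nk; rewrite /bit divn_small ?mod0n//.
case: k nk => // k; rewrite ltnS => nk.
have : k < 2 ^ k by exact: ltn_expl.
rewrite expnS; lia.
Qed.

Lemma slopingE (n : nat) :
  sloping n = \sum_(0 <= k < n.+1) bit k (n + k) * 2 ^ k.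
Proof.
rewrite /sloping (fsbigE (index_iota 0 n.+1)) ?iota_uniq//.
- by apply: eq_bigl => k; rewrite in_setT.
- move=> k _ /=; rewrite mem_index_iota ltnS /=.
  by case: leqP => // nk; rewrite bit_sloping_eq0.
Qed.

(* Main.v *)
(** Swapping sums, the digit of weight [2^k] contributes to
    [\sum_(n <= N) s(n) - \sum_(n <= N) n] only through the window
    [N < m <= N + k] that the shift by [k] brings in (the window [m <= k] that
    it drops has zero digits), i.e. at most [k * 2^k]. Only the positions
    [k <= trunc_log 2 N + 1] matter, so that the total is [O(N log N)]. *)
Require Import Defs.
From mathcomp Require Import zify.

Set Implicit Arguments.
Unset Strict Implicit.
Unset Printing Implicit Defensive.

Import Order.TTheory GRing.Theory Num.Theory.

Local Open Scope classical_set_scope.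
Local Open Scope ring_scope.

Lemma modn_expS (k n : nat) :
  (n %% 2 ^ k.+1 = n %% 2 ^ k + bit k n * 2 ^ k)%N.
Proof.
have k0 : (0 < 2 ^ k)%N by rewrite expn_gt0.
rewrite /bit {1}(divn_eq n (2 ^ k)) {1}(divn_eq (n %/ 2 ^ k) 2).
rewrite mulnDl -mulnA -expnS -addnA modnMDl modn_small 1?addnC//.
have := ltn_pmod n k0; have := ltn_pmod (n %/ 2 ^ k) (isT : 0 < 2)%N.
rewrite expnS; nia.
Qed.

Lemma sum_bit_modn (K n : nat) :
  (\sum_(0 <= k < K) bit k n * 2 ^ k = n %% 2 ^ K)%N.
Proof.
elim: K => [|K IH]; first by rewrite big_nil modn1.
by rewrite big_nat_recr//= IH modn_expS.
Qed.

Lemma bit_small (k m : nat) : (m < 2 ^ k)%N -> bit k m = 0%N.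
Proof. by move=> mk; rewrite /bit divn_small. Qed.

(** For [k > K], both [n] and [k] fit below the digit: [n < 2 ^ (k - 1)] and [k <= 2 ^ (k - 1)], so
    [n + k < 2 ^ k]. One logarithmic cutoff [K] thus serves all [n <= N]. *)
Lemma sloping_trunc (K n : nat) : (n < 2 ^ K)%N ->
  sloping n = (\sum_(0 <= k < K.+1) bit k (n + k) * 2 ^ k)%N.
Proof.
move=> nK; rewrite /sloping (fsbigE (index_iota 0 K.+1)) ?iota_uniq//.
- by apply: eq_bigl => k; rewrite in_setT.
- move=> k _ /=; rewrite mem_index_iota /=.
  case: ltnP => //; case: k => // k; rewrite ltnS => Kk.
  have Kk2 : (2 ^ K <= 2 ^ k)%N by rewrite leq_exp2l.
  have kk2 : (k < 2 ^ k)%N by exact: ltn_expl.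
  by rewrite bit_small// expnS; lia.
Qed.

Lemma sum_bit_shift (k N : nat) :
  (\sum_(1 <= n < N.+1) bit k (n + k) =
   \sum_(1 <= n < N.+1) bit k n + \sum_(N.+1 <= n < N.+1 + k) bit k n)%N.
Proof.
rewrite -big_cat_nat ?leq_addr//= [RHS](@big_cat_nat _ _ _ k.+1)//=; last by lia.
rewrite [X in (_ = X + _)%N]big1_seq => [|m]; last first.
  rewrite mem_index_iota => /and3P[_ _ mk].
  by rewrite bit_small// (leq_trans mk)// ltn_expl.
by rewrite add0n -[k.+1]add1n big_addn addnK.
Qed.

(** The geometric growth of [2 ^ k] is what counts: bounding every term by the last one would cost
    an extra factor of order [K], hence an extra logarithm. *)
Lemma sum_mul_exp2 (K : nat) :
  (\sum_(0 <= k < K.+1) k * 2 ^ k <= K * 2 ^ K.+1)%N.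
Proof.
elim: K => [|K IH]; first by rewrite big_nat1.
by rewrite big_nat_recr//= (leq_trans (leq_add IH (leqnn _)))// !expnS; nia.
Qed.

Lemma sum_sloping (N : nat) : (0 < N)%N ->
  exists2 D : nat,
    (\sum_(1 <= n < N.+1) sloping n = \sum_(1 <= n < N.+1) n + D)%N &
    (D <= 4 * N * (trunc_log 2 N).+1)%N.
Proof.
(* [K] is the binary length of [N]. *)
move=> N0; set K := (trunc_log 2 N).+1.
have NK : (N < 2 ^ K)%N by exact: trunc_log_ltn.
have KN : (2 ^ K <= 2 * N)%N by rewrite expnS leq_mul2l trunc_logP.
pose D k := (\sum_(N.+1 <= n < N.+1 + k) bit k n)%N.
exists (\sum_(0 <= k < K.+1) D k * 2 ^ k)%N.
  have -> : (\sum_(1 <= n < N.+1) sloping n =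
      \sum_(1 <= n < N.+1) \sum_(0 <= k < K.+1) bit k (n + k) * 2 ^ k)%N.
    apply: eq_big_nat => n /andP[_ /[!ltnS] nN].
    by rewrite (@sloping_trunc K)// (leq_ltn_trans nN NK).
  (* The digit at [k = K] is zero here; it is kept so that both double sums range over the same
     [k]. *)
  have -> : (\sum_(1 <= n < N.+1) n =
      \sum_(1 <= n < N.+1) \sum_(0 <= k < K.+1) bit k n * 2 ^ k)%N.
    apply: eq_big_nat => n /andP[_ /[!ltnS] nN].
    rewrite sum_bit_modn modn_small// (leq_ltn_trans nN)// (ltn_trans NK)//.
    by rewrite ltn_exp2l.
  rewrite exchange_big/= [X in (_ = X + _)%N]exchange_big -big_split/=.
  by apply: eq_bigr => k _; rewrite -!big_distrl/= sum_bit_shift mulnDl.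
(* The factor 4 comes from [2 ^ K.+1 = 2 * 2 ^ K <= 4 * N]. *)
apply: (@leq_trans (K * 2 ^ K.+1)); last by rewrite expnS; nia.
apply: leq_trans (sum_mul_exp2 K); apply: leq_sum => k _.
rewrite leq_mul2r; apply/orP; right.
(* Writing [k] as a sum of ones over the window reduces [D k <= k] to [bit k n <= 1]. *)
rewrite -[leqRHS](addKn N.+1 k) -[leqRHS]muln1 -sum_nat_const_nat.
by apply: leq_sum => n _; rewrite /bit -ltnS ltn_pmod.
Qed.

Theorem theorem8 (R : realType) :
  (fun N : nat => \sum_(1 <= n < N.+1) (sloping n)%:R : R) =
  (fun N : nat => \sum_(1 <= n < N.+1) n%:R : R) +O_\oo
  (fun N : nat => N%:R * ln (N%:R : R)).
Proof.
have ln2 : 0 < ln (2 : R) by rewrite ln_gt0// ltr1n.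
(* With [L = trunc_log 2 N], [N > 1] gives [L >= 1], so [4 * N * L.+1 <= 8 * N * L]; then
   [L * ln 2 <= ln N]. *)
apply/eqaddOP/bigO_exP; exists (8 / ln 2); first by rewrite divr_gt0.
near=> N.
have N1 : (1 < N)%N by near: N; exact: nbhs_infty_gt.
have N0 : (0 < N)%N by exact: ltnW.
rewrite !fctE/=.
have [D sumD DN] := sum_sloping N0.
rewrite -!natr_sum sumD natrD addrAC subrr add0r ger0_norm ?ler0n//.
rewrite ger0_norm ?mulr_ge0 ?ln_ge0 ?ler1n//.
have L1 : (0 < trunc_log 2 N)%N by rewrite trunc_log_gt0.
have lnN : (trunc_log 2 N)%:R * ln 2 <= ln (N%:R : R).
  rewrite mulr_natl -lnXn// ler_ln ?posrE ?exprn_gt0 ?ltr0n//.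
  by rewrite -natrX ler_nat trunc_logP.
apply: (@le_trans _ _ (8 * N * trunc_log 2 N)%:R).
  by rewrite ler_nat (leq_trans DN)//; nia.
rewrite [leRHS]mulrAC ler_pdivlMr// !natrM -!mulrA.
by rewrite ler_wpM2l// ler_wpM2l.
Unshelve. all: by end_near. Qed.
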